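(* Let $\psi:[0,1]\to\mathbb{R}$ be a continuous function belonging to $H^1(0,1)$, with $\psi(0)=0$, satisfying $\int_0^1(1-x)\,\psi(x)\,dx=0$ and $\psi(\theta)+\psi(1-\theta)=1$ for all $\theta\in[0,1]$. Let $$\widetilde\delta=\int_0^1\psi(\theta)^2\,d\theta,\qquad K=\frac43\Big(1+\sqrt{12\,\widetilde\delta}\Big).$$ Let $0<\alpha<1<\beta$ and let $\mathcal U_{\alpha,\beta}$ be the family of uniformly regular meshes. Let $C>0$ be a constant such that for every $\mathcal T\in\mathcal U_{\alpha,\beta}$ and every $u\in U_{\mathcal T}$ there exists $q\in Q^\psi_{\mathcal T}$ with $(u,\mathrm{div}\,q)=\|u\|_0^2$ and $\|q\|_1\le C\|u\|_0$. Let $\rho>0$ be chosen such that $$\rho+\sqrt{K\rho}\le\frac1C\sqrt{1-\rho^2-K\rho}.$$ Then the following uniform discrete inf-sup condition holds: for every $\mathcal T\in\mathcal U_{\alpha,\beta}$ and every $\xi=(u,p)\in U_{\mathcal T}\times P_{\mathcal T}$ with $\|\xi\|_V=1$, there exists $\eta=(v,q)\in U_{\mathcal T}\times Q^\psi_{\mathcal T}$ such that $$\|\eta\|_V\le1\quad\text{and}\quad\gamma(\xi,\eta)\ge\rho .$$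
   Context: Norms: $(\cdot,\cdot)$ and $\|\cdot\|_0$ are the scalar product and norm of $L^2(0,1)$; in one dimension $\mathrm{div}\,q=q'$; $\|q\|_1=(\|q\|_0^2+\|\mathrm{div}\,q\|_0^2)^{1/2}$. On $V=L^2(0,1)\times H^1(0,1)$ the norm is $\|(v,q)\|_V=(\|v\|_0^2+\|q\|_0^2+\|\mathrm{div}\,q\|_0^2)^{1/2}$. Meshes: a mesh $\mathcal T$ with $n=n_{\mathcal T}\ge1$ elements is a set of vertices $0=x_0<x_1<\dots<x_n=1$; its elements are $]x_j,x_{j+1}[$, with lengths $h_{j+1/2}=x_{j+1}-x_j$ ($0\le j\le n-1$). For $0<\alpha<1<\beta$, $\mathcal U_{\alpha,\beta}$ is the class of all meshes such that $\alpha/n_{\mathcal T}\le h_{j+1/2}\le\beta/n_{\mathcal T}$ for all $j=0,\dots,n_{\mathcal T}-1$. Discrete spaces: $U_{\mathcal T}$ is the space of functions that are constant on each element. $P_{\mathcal T}$ is the space of continuous functions on $[0,1]$ that are affine on each element. $Q^\psi_{\mathcal T}$ is the linear span of the functions $\psi_0,\dots,\psi_n$ on $[0,1]$ defined by $\psi_j(x)=\psi\big(\frac{x-x_{j-1}}{h_{j-1/2}}\big)$ if $x_{j-1}\le x\le x_j$, $\psi_j(x)=\psi\big(\frac{x_{j+1}-x}{h_{j+1/2}}\big)$ if $x_j\le x\le x_{j+1}$, and $\psi_j(x)=0$ elsewhere (for $j=0$ and $j=n$ only the piece lying in $[0,1]$ is used). Bilinear form: $\gamma((u,p),(v,q))=(p,q)+(u,\mathrm{div}\,q)+(\mathrm{div}\,p,v)$.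 *)

(* Defs.v *)
From HB Require Import structures.
From mathcomp Require Import all_boot all_order all_algebra.
From mathcomp Require Import all_classical all_reals all_analysis.
Set Implicit Arguments.
Unset Strict Implicit.
Unset Printing Implicit Defensive.
Import Order.TTheory GRing.Theory Num.Theory.
Import numFieldNormedType.Exports.
Local Open Scope classical_set_scope.
Local Open Scope ring_scope.

(* A function on ]0,1[ or [0,1] is represented by a
   total function R -> R whose values outside the interval are irrelevant. *)

Section FunctionSpaces.
Context {R : realType}.
Implicit Types (f g q phi : R -> R) (xi eta : (R -> R) * (R -> R)).

Definition L2 f : Prop :=
  measurable_fun (`]0, 1[ : set R) f /\
  lebesgue_measure.-integrable (`]0, 1[ : set R) (fun x => (f x ^+ 2)%:E).

Definition dotL2 f g : R :=
  \int[lebesgue_measure]_(x in `]0, 1[) (f x * g x).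

Definition norm0 f : R := Num.sqrt (dotL2 f f).

(* C^1 functions with compact support in ]0,1[, extended by 0 to R *)
Definition test_fun phi : Prop :=
  [/\ forall x, derivable phi x 1,
      continuous (derive1 phi),
      compact (closure [set x | phi x != 0]) &
      closure [set x | phi x != 0] `<=` `]0, 1[].

(* q is in H^1(0,1), with weak derivative g *)
Definition is_H1_deriv q g : Prop :=
  [/\ L2 q, L2 g &
      forall phi, test_fun phi -> dotL2 q (derive1 phi) = - dotL2 g phi].

Definition H1 q : Prop := exists g, is_H1_deriv q g.

(* A representative of the weak derivative of q; it is unique up to a.e.
   equality.  The value 0 is a dummy used only when q is not in H^1(0,1). *)
Definition div q : R -> R := xget (cst 0) [set g | is_H1_deriv q g].

Definition norm1 q : R := Num.sqrt (norm0 q ^+ 2 + norm0 (div q) ^+ 2).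

Definition normV xi : R :=
  Num.sqrt (norm0 xi.1 ^+ 2 + norm0 xi.2 ^+ 2 + norm0 (div xi.2) ^+ 2).

Definition bilin_gamma xi eta : R :=
  dotL2 xi.2 eta.2 + dotL2 xi.1 (div eta.2) + dotL2 (div xi.2) eta.1.

End FunctionSpaces.

(* Only the vertices of index at most [nelt] are meaningful. *)
Record mesh (R : realType) := Mesh {
  nelt : nat;
  vtx : nat -> R;
  nelt_gt0 : (0 < nelt)%N;
  vtx_first : vtx 0%N = 0;
  vtx_last : vtx nelt = 1;
  vtx_incr : forall j, (j < nelt)%N -> vtx j < vtx j.+1
}.

Section DiscreteSpaces.
Context {R : realType}.
Implicit Types (T : mesh R) (psi f : R -> R).

(* [hstep T j] is the length h_{j+1/2} of the element ]x_j, x_{j+1}[ *)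
Definition hstep T (j : nat) : R := vtx T j.+1 - vtx T j.

Definition uniformly_regular (alpha beta : R) : set (mesh R) :=
  [set T | forall j, (j < nelt T)%N ->
     alpha / (nelt T)%:R <= hstep T j <= beta / (nelt T)%:R].

Definition Uspace T : set (R -> R) :=
  [set u | forall j, (j < nelt T)%N ->
     exists c, forall x, vtx T j < x < vtx T j.+1 -> u x = c].

Definition Pspace T : set (R -> R) :=
  [set p : R -> R | {within `[0, 1], continuous p} /\
     forall j, (j < nelt T)%N ->
       exists a b, forall x, vtx T j < x < vtx T j.+1 -> p x = a * x + b].

(* The guards on j drop the piece lying outside [0,1] when j = 0 or j = n. *)
Definition psi_basis psi T (j : nat) (x : R) : R :=
  if [&& (0 < j)%N, vtx T j.-1 <= x & x <= vtx T j] then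
    psi ((x - vtx T j.-1) / hstep T j.-1)
  else if [&& (j < nelt T)%N, vtx T j <= x & x <= vtx T j.+1] then
    psi ((vtx T j.+1 - x) / hstep T j)
  else 0.

Definition Qspace psi T : set (R -> R) :=
  [set q | exists c : nat -> R, forall x, 0 <= x <= 1 ->
     q x = \sum_(j < (nelt T).+1) c j * psi_basis psi T j x].

End DiscreteSpaces.

(* Main.v *)
Require Import Defs.
From HB Require Import structures.
From mathcomp Require Import all_boot all_order all_algebra.
From mathcomp Require Import all_classical all_reals all_analysis.
From mathcomp Require Import measurable_realfun.
From mathcomp Require Import ring lra.
Import Order.TTheory GRing.Theory Num.Theory.
Import numFieldNormedType.Exports.
Local Open Scope classical_set_scope.
Local Open Scope ring_scope.

(** The inf-sup inequality is obtained from one of three test pairs, according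
    to which part of [xi = (u, p)] carries its norm.
    - If [p'] is large, [||p'|| >= rho], the normalised pair
      [(p' / ||p'||, 0)] gives [gamma = ||p'||].
    - If the mean [m] of [p] is large, [|m| >= rho], the pair [(0, sgn m)]
      gives [gamma = |m|]: constants lie in the span of the [psi_j], because
      the two shape functions of a cell add up to 1 ([cst_Qspace]), and their
      divergence vanishes.
    - Otherwise [p] oscillates by at most [||p'|| < rho] about its value at 0
      ([Pspace_oscillation]), hence [||p||^2 <= m^2 + ||p'||^2 <= 2 rho^2]
      ([sqr_norm0_Pspace]).  The condition on [rho] forces [2 rho <= K], so
      [||p||^2 <= K rho] and [||u||^2 >= 1 - rho^2 - K rho].  The stability
      hypothesis, applied to the multiple of [u] for which it yields
      [||q||_1 <= 1], gives [(u, div q) = ||u|| / C], and the pair [(0, q)]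
      satisfies [gamma >= ||u|| / C - ||p|| >= rho].

    All this needs the divergence, which is an arbitrarily chosen weak
    derivative, to be computable: a weak derivative is unique almost everywhere
    ([weak_derivative_unique]), and for a continuous piecewise affine function
    the pointwise derivative is one ([Pspace_is_H1_deriv]). *)

(** * The scalar product of square integrable functions *)

Section SquareIntegrable.
Set Implicit Arguments.
Unset Strict Implicit.
Unset Printing Implicit Defensive.
Context {R : realType}.
Implicit Types f g h : R -> R.
Local Notation mu := lebesgue_measure.
Local Notation I := (`]0%R, 1%R[%classic : set R).

(** The product is dominated by [f ^+ 2 + g ^+ 2]. *)
Lemma L2_mul_integrable f g : L2 f -> L2 g ->
  mu.-integrable I (EFin \o (fun x => f x * g x)).
Proof.
move=> [mf f2] [mg g2].
apply: (le_integrable _ _ _ (integrableD _ f2 g2)) => //.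
  by apply/measurable_EFinP; exact: measurable_funM.
move=> x _ /=; rewrite lee_fin [leRHS]ger0_norm ?addr_ge0 ?sqr_ge0//.
by rewrite ler_norml; apply/andP; split; nra.
Qed.

Lemma bounded_L2 f (M : R) : measurable_fun I f ->
  (forall x, 0 < x < 1 -> `|f x| <= M) -> L2 f.
Proof.
move=> mf fM; split => //; apply: measurable_bounded_integrable => //.
- by rewrite /= lebesgue_measure_itv/= lte01 oppr0 adde0 ltry.
- exact: measurable_funX.
exists (M ^+ 2); split; first exact: num_real.
move=> y My x /=; rewrite in_itv/= => /fM fxM.
by rewrite (le_trans _ (ltW My))// normrX lerXn2r// nnegrE (le_trans _ fxM).
Qed.

Lemma cst_L2 (c : R) : L2 (cst c).
Proof. by apply: (@bounded_L2 _ `|c|). Qed.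

Lemma L2D f g : L2 f -> L2 g -> L2 (fun x => f x + g x).
Proof.
move=> Lf Lg; have [mf f2] := Lf; have [mg g2] := Lg.
split; first exact: measurable_funD.
have fg := L2_mul_integrable Lf Lg.
apply: (eq_integrable _ _ _ _ (integrableD _ f2 (integrableD _ (integrableZl _ 2 fg) g2))) => //.
by move=> x _ /=; rewrite -EFinM -!EFinD; congr (_%:E); ring.
Qed.

Lemma L2Z (c : R) f : L2 f -> L2 (fun x => c * f x).
Proof.
move=> [mf f2]; split; first exact: measurable_funM.
apply: (eq_integrable _ _ _ _ (integrableZl _ (c ^+ 2) f2)) => //.
by move=> x _ /=; rewrite -EFinM exprMn.
Qed.

Lemma L2_integrable f : L2 f -> mu.-integrable I (EFin \o f).
Proof.
move=> Lf; apply: (eq_integrable _ _ _ _ (L2_mul_integrable Lf (cst_L2 1))) => //.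
by move=> x _ /=; rewrite mulr1.
Qed.

Lemma dotL2C f g : dotL2 f g = dotL2 g f.
Proof. by apply: eq_Rintegral => x _; rewrite mulrC. Qed.

Lemma eq_dotL2 f f' g g' :
  (forall x, 0 < x < 1 -> f x * g x = f' x * g' x) -> dotL2 f g = dotL2 f' g'.
Proof. by move=> e; apply: eq_Rintegral => x; rewrite inE/= in_itv/=; exact: e. Qed.

Lemma dotL2Dl f g h : L2 f -> L2 g -> L2 h ->
  dotL2 (fun x => f x + g x) h = dotL2 f h + dotL2 g h.
Proof.
move=> Lf Lg Lh; rewrite /dotL2 -RintegralD//; last 2 first.
- exact: L2_mul_integrable.
- exact: L2_mul_integrable.
by apply: eq_Rintegral => x _; rewrite mulrDl.
Qed.

Lemma dotL2Zl (c : R) f h : L2 f -> L2 h ->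
  dotL2 (fun x => c * f x) h = c * dotL2 f h.
Proof.
move=> Lf Lh; rewrite /dotL2 -RintegralZl//; last exact: L2_mul_integrable.
by apply: eq_Rintegral => x _; rewrite mulrA.
Qed.

Lemma dotL2_ge0 f : 0 <= dotL2 f f.
Proof. by apply: Rintegral_ge0 => x _; rewrite -expr2 sqr_ge0. Qed.

Lemma norm0_ge0 f : 0 <= norm0 f.
Proof. exact: sqrtr_ge0. Qed.

Lemma sqr_norm0 f : norm0 f ^+ 2 = dotL2 f f.
Proof. by rewrite sqr_sqrtr// dotL2_ge0. Qed.

Lemma dotL2_cst (c d : R) : dotL2 (cst c) (cst d) = c * d.
Proof.
rewrite /dotL2 /= Rintegral_cst//= lebesgue_measure_itv/= lte01.
by rewrite oppr0 adde0/= mulr1.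
Qed.

Lemma norm0_cst (c : R) : norm0 (cst c) = `|c|.
Proof. by rewrite /norm0 dotL2_cst -expr2 sqrtr_sqr. Qed.

Lemma dotL20 f : dotL2 f (cst 0) = 0.
Proof. by rewrite (@eq_dotL2 _ (cst 0) _ (cst 0)) ?dotL2_cst ?mulr0// => x _; rewrite !mulr0. Qed.

Lemma norm0Z (c : R) f : L2 f -> norm0 (fun x => c * f x) = `|c| * norm0 f.
Proof.
move=> Lf; rewrite /norm0 dotL2Zl//; last exact: L2Z.
by rewrite dotL2C dotL2Zl// mulrA -expr2 sqrtrM ?sqr_ge0// sqrtr_sqr.
Qed.

(** Cauchy-Schwarz: the squared norm of [f + t g] is a nonnegative quadratic
    polynomial in [t]. *)
Lemma ler_dotL2 f g : L2 f -> L2 g -> `|dotL2 f g| <= norm0 f * norm0 g.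
Proof.
move=> Lf Lg.
rewrite -ler_sqr ?nnegrE ?mulr_ge0 ?norm0_ge0// exprMn !sqr_norm0 real_normK ?num_real//.
have quad t : 0 <= dotL2 f f + 2 * t * dotL2 f g + t ^+ 2 * dotL2 g g.
  have := dotL2_ge0 (fun x => f x + t * g x).
  have Ltg := L2Z t Lg; have Ls := L2D Lf Ltg.
  rewrite dotL2Dl// dotL2Zl// ![dotL2 _ (fun x => _ + _)]dotL2C !dotL2Dl//.
  by rewrite !dotL2Zl// (dotL2C g f); congr (0 <= _); ring.
have := dotL2_ge0 g; rewrite le_eqVlt => /predU1P[g0|g0].
  have [->|fg0] := eqVneq (dotL2 f g) 0.
    by rewrite expr0n/= mulr_ge0 ?dotL2_ge0.
  (* When [norm0 g = 0] the polynomial is affine; at this [t] it would be -1. *)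
  have := quad (- (dotL2 f f + 1) / (2 * dotL2 f g)).
  rewrite -g0 mulr0 addr0 (_ : _ + _ = -1) ?lerN10//; last by field.
  by move: (ltrN10 R) => /lt_le_trans h /h; rewrite ltxx.
(* the minimiser of the polynomial *)
have := quad (- dotL2 f g / dotL2 g g).
rewrite (_ : _ + _ = (dotL2 f f * dotL2 g g - dotL2 f g ^+ 2) / dotL2 g g); last first.
  by field; rewrite gt_eqF.
by rewrite pmulr_lge0 ?invr_gt0// subr_ge0.
Qed.

Lemma ae_eq_dotL2 f f' g : L2 f -> L2 f' -> L2 g ->
  {ae mu, forall x, I x -> f x = f' x} -> dotL2 f g = dotL2 f' g.
Proof.
move=> Lf Lf' Lg ff'; congr fine; apply: ae_eq_integral => //.
- exact/measurable_int/L2_mul_integrable.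
- exact/measurable_int/L2_mul_integrable.
apply: filterS ff'; first exact: (ae_filter_ringOfSetsType mu).
by move=> x ff' /ff' /= ->.
Qed.

End SquareIntegrable.

(** * Test functions and uniqueness of weak derivatives *)

Section WeakDerivatives.
Set Implicit Arguments.
Unset Strict Implicit.
Unset Printing Implicit Defensive.
Context {R : realType}.
Implicit Types (f g phi q : R -> R) (a b x : R).
Local Notation mu := lebesgue_measure.
Local Notation I := (`]0%R, 1%R[%classic : set R).

Definition pospart x := Num.max 0 x.

Lemma continuous_pospart : continuous pospart.
Proof.
move=> x; apply: (@continuous_max _ _ (cst 0) id).
  exact: cst_continuous.
exact: cvg_id.
Qed.

(** The square makes the positive part continuously differentiable: the only
    delicate point is 0, where [pospart z] is the Caratheodory slope. *)
Lemma is_derive_sqr_pospart x : is_derive x 1 (fun t => pospart t ^+ 2) (2 * pospart x).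
Proof.
have [x0|x0|->] := ltgtP x 0.
- apply: (@near_eq_is_derive _ _ _ (cst 0)).
    near=> t; rewrite /pospart max_l ?expr0n//.
    by apply/ltW; near: t; exact: lt_nbhsl.
  rewrite /pospart max_l ?mulr0 ?(ltW x0)//; exact: is_derive_cst.
- have dX : is_derive x 1 (fun t : R => t ^+ 2) (2 * pospart x).
    by apply: is_derive_eq; rewrite /pospart max_r ?(ltW x0)//= /GRing.scale/=; ring.
  apply: near_eq_is_derive dX.
  near=> t; rewrite /pospart max_r//.
  by apply/ltW; near: t; exact: lt_nbhsr.
apply/is_derive1_caratheodory; exists pospart; split.
- move=> z; rewrite /pospart /Num.max ltxx expr0n/= !subr0 expr2.
  by case: ifP => //; rewrite !mul0r.
- exact: continuous_pospart.
- by rewrite /pospart maxxx mulr0.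
Unshelve. all: by end_near. Qed.

(** For [a < b], a C^1 function that is positive exactly on [`]a, b[]. *)
Definition bump a b x := pospart ((x - a) * (b - x)) ^+ 2.
Definition dbump a b x := 2 * pospart ((x - a) * (b - x)) * (a + b - 2 * x).

Lemma is_derive_bump a b x : is_derive x 1 (bump a b) (dbump a b x).
Proof.
apply: (@is_derive1_comp _ (fun t => pospart t ^+ 2) (fun x => (x - a) * (b - x))).
  exact: is_derive_sqr_pospart.
apply: is_derive_eq; rewrite /GRing.scale/=; ring.
Qed.

(** This is [n w / (1 + n w)] with [w = bump a b], written so as to be easy to
    differentiate; it increases to the indicator of [`]a, b[] with [n]. *)
Definition cutoff a b (n : nat) x := 1 - (1 + n%:R * bump a b x)^-1.

Lemma bump_ge0 a b x : 0 <= bump a b x. Proof. exact: sqr_ge0. Qed.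

Let den_gt0 a b (n : nat) x : 0 < 1 + n%:R * bump a b x.
Proof. by rewrite ltr_pwDl// mulr_ge0// bump_ge0. Qed.

Lemma is_derive_cutoff a b n x : is_derive x 1 (cutoff a b n)
  (n%:R * dbump a b x * (1 + n%:R * bump a b x) ^- 2).
Proof.
have db := is_derive_bump a b x.
have dd : is_derive x 1 (fun x => 1 + n%:R * bump a b x) (n%:R * dbump a b x).
  by apply: is_derive_eq; rewrite /GRing.scale/=; ring.
have := @is_deriveV _ (fun x => 1 + n%:R * bump a b x) _ _ _ (lt0r_neq0 (den_gt0 a b n x)) dd.
move=> dV; apply: is_derive_eq; rewrite /GRing.scale/=; ring.
Qed.

Lemma derive1_cutoff a b n : derive1 (cutoff a b n) =
  (fun x => n%:R * dbump a b x * (1 + n%:R * bump a b x) ^- 2).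
Proof.
apply/funext => x; rewrite derive1E.
by have dc := is_derive_cutoff a b n x; rewrite derive_val.
Qed.

Lemma bump_eq0 a b x : ~~ (a < x < b) -> a < b -> bump a b x = 0.
Proof.
move=> xab ab; rewrite /bump /pospart max_l ?expr0n//.
move: xab; rewrite negb_and -!leNgt => /orP[]; nra.
Qed.

Lemma bump_gt0 a b x : a < x < b -> 0 < bump a b x.
Proof.
move=> /andP[ax xb]; have h : 0 < (x - a) * (b - x) by rewrite mulr_gt0// subr_gt0.
by rewrite /bump /pospart max_r ?exprn_gt0// ltW.
Qed.

Lemma continuous_bump a b : continuous (bump a b).
Proof.
move=> x; apply: differentiable_continuous; apply/derivable1_diffP.
by have [] := is_derive_bump a b x.
Qed.

Lemma test_fun_cutoff a b n : 0 < a -> a < b -> b < 1 -> test_fun (cutoff a b n).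
Proof.
move=> a0 ab b1.
have supp : closure [set x | cutoff a b n x != 0] `<=` `[a, b].
  rewrite [X in _ `<=` X](iffLR (closure_id _)); last exact: itv_closed.
  apply: closureS => x /=; apply: contraR => xab.
  rewrite /cutoff bump_eq0 ?mulr0 ?addr0 ?invr1 ?subrr//.
  apply: contra xab => /andP[ax xb]; rewrite in_itv/=; lra.
split.
- by move=> x; have [] := is_derive_cutoff a b n x.
- rewrite derive1_cutoff => x; apply: cvgM; last first.
    apply: cvgV; first by rewrite expf_neq0// lt0r_neq0.
    apply: (@continuous_comp _ _ _ (fun x => 1 + n%:R * bump a b x) (fun t => t ^+ 2)).
      apply: cvgD; first exact: cvg_cst.
      by apply: cvgM; [exact: cvg_cst|exact: continuous_bump].
    exact: exprn_continuous.
  apply: cvgM; first exact: cvg_cst.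
  apply: cvgM; last first.
    apply: cvgB; first exact: cvg_cst.
    by apply: cvgM; [exact: cvg_cst|exact: cvg_id].
  apply: cvgM; first exact: cvg_cst.
  apply: (@continuous_comp _ _ _ (fun x => (x - a) * (b - x)) pospart); last exact: continuous_pospart.
  apply: cvgM; apply: cvgB; first exact: cvg_id; first exact: cvg_cst.
    exact: cvg_cst.
  exact: cvg_id.
- exact: (subclosed_compact (@closed_closure _ _) (@segment_compact _ a b)).
- apply: subset_trans supp _ => x /=; rewrite !in_itv/=; lra.
Qed.

Lemma cutoff_ge0_le1 a b n x : 0 <= cutoff a b n x <= 1.
Proof.
have h := den_gt0 a b n x; have := bump_ge0 a b x => w0.
rewrite /cutoff subr_ge0 gerBl invr_ge0 (ltW h) andbT invf_le1//.
by rewrite lerDl mulr_ge0.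
Qed.

Lemma cvg_cutoff a b x : a < b ->
  cutoff a b n x @[n --> \oo] --> (\1_(`]a, b[%classic : set R) x : R).
Proof.
move=> ab; rewrite indicE; have [xab|xab] := boolP (a < x < b); last first.
  rewrite memNset/=; last by rewrite in_itv/=; exact/negP.
  rewrite /cutoff bump_eq0//; under eq_fun do rewrite mulr0 addr0 invr1 subrr.
  exact: cvg_cst.
rewrite mem_set/=; last by rewrite in_itv/=.
rewrite -[X in _ --> X]subr0; apply: cvgB; first exact: cvg_cst.
have w0 := bump_gt0 xab.
apply/gtr0_cvgV0; first by near=> n; exact: den_gt0.
apply/cvgryPge => M; near=> n.
have : M / bump a b x <= n%:R by near: n; exact: nbhs_infty_ger.
rewrite ler_pdivrMr// => /le_trans; apply; lra.
Unshelve. all: by end_near. Qed.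

Lemma within_continuous_L2 f : {within `[0, 1], continuous f} -> L2 f.
Proof.
move=> cf.
have [M [_ fM]] := compact_bounded (continuous_compact cf (@segment_compact _ 0 1)).
apply: (@bounded_L2 _ _ (M + 1)) => [|x /andP[x0 x1]].
  apply: (@measurable_funS _ _ _ _ (`[0%R, 1%R]%classic : set R)) => //.
    by move=> x; rewrite /= !in_itv/= => /andP[/ltW -> /ltW].
  exact: subspace_continuous_measurable_fun.
apply: (fM (M + 1)); first by rewrite ltrDl.
by exists x => //=; rewrite in_itv/= !ltW.
Qed.

Lemma test_fun_L2 phi : test_fun phi -> L2 phi.
Proof.
move=> [dphi _ _ _]; apply/within_continuous_L2/continuous_subspaceT => x.
exact/differentiable_continuous/derivable1_diffP.
Qed.

Lemma derive1_test_fun_L2 phi : test_fun phi -> L2 (derive1 phi).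
Proof. by move=> [_ cphi _ _]; exact/within_continuous_L2/continuous_subspaceT. Qed.

(** The cutoffs are test functions that converge to the indicator of [`]a, b[]
    while staying between 0 and 1, so dominated convergence applies. *)
Lemma Rintegral_itv_eq0_of_orthogonal g a b : L2 g ->
  (forall phi, test_fun phi -> dotL2 g phi = 0) ->
  0 < a -> a < b -> b < 1 -> \int[mu]_(x in `]a, b[) g x = 0.
Proof.
move=> Lg g0 a0 ab b1.
have tc n := @test_fun_cutoff a b n a0 ab b1.
have mg : measurable_fun I g by case: Lg.
have [] := @dominated_convergence _ _ _ mu I (measurable_itv _)
  (fun n x => (g x * cutoff a b n x)%:E) (fun x => (g x * \1_`]a, b[ x)%:E)
  (fun x => `|g x|%:E).
- by move=> n; apply/measurable_EFinP/measurable_funM => //; have [] := test_fun_L2 (tc n).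
- by apply/measurable_EFinP/measurable_funM.
- apply: aeW => x _; apply/cvg_EFin; first by apply: nearW.
  by apply: cvgM; [exact: cvg_cst|exact: cvg_cutoff].
- by have /integrable_abse := L2_integrable Lg.
- apply: aeW => x n _; rewrite lee_fin normrM ler_piMr//.
  by have /andP[c0 c1] := cutoff_ge0_le1 a b n x; rewrite ger0_norm.
move=> ig _ cg.
have e n : (\int[mu]_(x in I) (g x * cutoff a b n x)%:E)%E = 0%E.
  rewrite -[LHS]fineK ?integrable_fin_num//; last exact/L2_mul_integrable/test_fun_L2.
  by congr EFin; exact: g0.
have : (\int[mu]_(x in I) (g x * \1_`]a, b[ x)%:E)%E = 0%E.
  by apply: (cvg_unique _ cg) => //; apply: cvg_near_cst; apply: nearW => n; exact: e.
move=> e0; transitivity (\int[mu]_(x in I) (g x * \1_`]a, b[ x)); last first.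
  by rewrite /Rintegral e0.
rewrite {1}(_ : `]a, b[ = I `&` `]a, b[)%classic; last first.
  apply/seteqP; split=> x /=; last by case.
  by rewrite !in_itv/= => /andP[ax xb]; rewrite (lt_trans a0 ax) (lt_trans xb b1) ax xb.
rewrite Rintegral_mkcondr; apply: eq_Rintegral => x xI.
by rewrite patchE indicE; case: ifP => xab; rewrite ?mulr1 ?mulr0.
Qed.

(** The primitive of [g] is constant on [`]0, 1[], and almost everywhere [g] is
    the derivative of its primitive. *)
Lemma ae_eq0_of_orthogonal g : L2 g ->
  (forall phi, test_fun phi -> dotL2 g phi = 0) ->
  {ae mu, forall x, I x -> g x = 0}.
Proof.
move=> Lg g0; pose gI := g \_ I.
have igI D : measurable D -> mu.-integrable D (EFin \o gI).
  move=> mD; apply: (@integrableS _ _ _ _ setT) => //.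
  rewrite -restrict_EFin; apply/integrable_restrict => //=.
  by rewrite setTI; exact: L2_integrable.
have lgI : locally_integrable [set: R] gI.
  by apply: open_integrable_locally => //; [exact: openT|exact: igI].
have := FTC1Ny (fun y => igI _ (measurable_itv _)) lgI.
apply: filterS; first exact: (ae_filter_ringOfSetsType mu).
move=> x [_ Fx] xI; have : gI x = g x by rewrite /gI patchE mem_set.
move=> <-; rewrite -Fx derive1E.
pose F y := \int[mu]_(t in `]-oo, y]) gI t.
rewrite (@near_eq_derive _ _ _ _ (cst (F x))) ?derive_cst//.
have incr y z : 0 < y -> y < z -> z < 1 -> F y = F z.
  move=> y0 yz z1; apply/esym/eqP; rewrite -subr_eq0 /F Rintegral_itvB//.
  - rewrite -Rintegral_itv_bndo_bndc; last exact: igI.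
    rewrite -[X in _ == X](Rintegral_itv_eq0_of_orthogonal Lg g0 y0 yz z1); apply/eqP.
    apply: eq_Rintegral => t; rewrite inE/= in_itv/= => /andP[yt tz].
    by rewrite /gI patchE mem_set//= in_itv/= (lt_trans y0 yt) (lt_trans tz z1).
  - exact: igI.
  - by rewrite bnd_simp ltW.
have := @near_in_itvoo _ 0 1 x xI.
apply: filterS => y; move: xI; rewrite /= !in_itv/= => /andP[x0 x1] /andP[y0 y1].
by have [xy|yx|->//] := ltgtP x y; [apply/esym|]; exact: incr.
Qed.

Lemma weak_derivative_unique q g h : is_H1_deriv q g -> is_H1_deriv q h ->
  {ae mu, forall x, I x -> g x = h x}.
Proof.
move=> [_ Lg qg] [_ Lh qh].
have LNh := L2Z (-1) Lh.
have := @ae_eq0_of_orthogonal (fun x => g x + (-1) * h x) (L2D Lg LNh).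
have h0 phi : test_fun phi -> dotL2 (fun x => g x + (-1) * h x) phi = 0.
  move=> tphi; have Lphi := test_fun_L2 tphi.
  rewrite dotL2Dl// dotL2Zl// mulN1r.
  by have := qg _ tphi; rewrite qh// => /oppr_inj ->; rewrite subrr.
move=> /(_ h0); apply: filterS; first exact: (ae_filter_ringOfSetsType mu).
by move=> x gh /gh; rewrite mulN1r => /eqP; rewrite subr_eq0 => /eqP.
Qed.

Lemma is_H1_deriv_div q g : is_H1_deriv q g -> is_H1_deriv q (div q).
Proof. by move=> qg; rewrite /div; case: xgetP => [d _ //|/(_ g)]; apply. Qed.

(** Scalar products and norms of [div q] may be computed with any weak
    derivative of [q], whichever representative [div] selects. *)
Lemma dotL2_div q g f : is_H1_deriv q g -> L2 f -> dotL2 f (div q) = dotL2 f g.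
Proof.
move=> qg Lf; have qd := is_H1_deriv_div qg.
rewrite ![dotL2 f _]dotL2C; apply: ae_eq_dotL2 => //.
- by case: qd.
- by case: qg.
- exact: weak_derivative_unique qd qg.
Qed.

Lemma norm0_div q g : is_H1_deriv q g -> norm0 (div q) = norm0 g.
Proof.
move=> qg; rewrite /norm0 (dotL2_div qg); last by case: (is_H1_deriv_div qg).
by rewrite dotL2C (dotL2_div qg)//; case: qg.
Qed.

Lemma test_fun_ends phi : test_fun phi -> phi 0 = 0 /\ phi 1 = 0.
Proof.
move=> [_ _ _ supp].
have out x : ~~ (0 < x < 1) -> phi x = 0.
  move=> x01; apply/eqP; apply: contraNT x01 => phix.
  by have := supp x (@subset_closure _ [set x | phi x != 0] x phix); rewrite /= in_itv.
by split; apply: out; rewrite ltxx ?andbF.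
Qed.

End WeakDerivatives.

(** * Piecewise constant and piecewise affine functions on a mesh *)

Section Mesh.
Set Implicit Arguments.
Unset Strict Implicit.
Unset Printing Implicit Defensive.
Context {R : realType}.
Implicit Types (T : mesh R) (f p phi psi : R -> R) (x : R).
Local Notation mu := lebesgue_measure.
Local Notation I := (`]0%R, 1%R[%classic : set R).

Lemma vtx_le T i j : (i <= j)%N -> (j <= nelt T)%N -> vtx T i <= vtx T j.
Proof.
elim: j => [|j IH]; first by rewrite leqn0 => /eqP ->.
rewrite leq_eqVlt => /predU1P[->//|ij jn].
exact: le_trans (IH ij (ltnW jn)) (ltW (vtx_incr jn)).
Qed.

Lemma vtx_itv T j : (j <= nelt T)%N -> 0 <= vtx T j <= 1.
Proof.
move=> jn; have := vtx_le (leq0n j) jn; have := vtx_le jn (leqnn _).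
by rewrite vtx_first vtx_last => -> ->.
Qed.

Lemma mesh_cell T x : 0 <= x <= 1 ->
  exists2 k, (k < nelt T)%N & vtx T k <= x <= vtx T k.+1.
Proof.
move=> /andP[x0 x1].
suff H m : (m <= nelt T)%N -> x <= vtx T m -> (0 < m)%N ->
    exists2 k, (k < nelt T)%N & vtx T k <= x <= vtx T k.+1.
  by apply: (H (nelt T)); rewrite ?vtx_last ?nelt_gt0.
elim: m => [//|m IH mn xm _].
have [mx|xm'] := leP (vtx T m) x; first by exists m; rewrite ?mx.
apply: IH (ltnW mn) (ltW xm') _; rewrite lt0n; apply: contraTneq xm' => ->.
by rewrite vtx_first -leNgt.
Qed.

Lemma elementwise_prefix T k : (k < nelt T)%N ->
  `]0, vtx T k.+1[%classic =
  (`]0%R, vtx T k] `|` `]vtx T k, vtx T k.+1[)%classic :> set R.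
Proof.
move=> kn; have kk := vtx_incr kn; have /andP[k0 _] := vtx_itv (ltnW kn).
apply/seteqP; split=> x /=; rewrite !in_itv/=.
  by move=> /andP[x0 xk]; have [xk'|xk'] := leP x (vtx T k); [left|right]; rewrite ?x0.
by case=> /andP[xa xb]; rewrite ?xa ?xb ?(le_lt_trans xb kk) ?(le_lt_trans k0 xa).
Qed.

(** The vertices, where nothing is known about [f], are singletons and hence
    harmless; the same remark makes [elementwise_bounded] true. *)
Lemma elementwise_measurable T f :
  (forall j, (j < nelt T)%N -> measurable_fun `]vtx T j, vtx T j.+1[ f) ->
  measurable_fun I f.
Proof.
move=> mf; rewrite -(vtx_last T).
suff H k : (k <= nelt T)%N -> measurable_fun `]0, vtx T k[ f by exact: H.
elim: k => [_|k IH kn].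
  by rewrite vtx_first set_itvoo0; exact: measurable_fun_set0.
rewrite elementwise_prefix//; apply/measurable_funU => //; split; last exact: mf.
have [-> |k0] := posnP k.
  by rewrite vtx_first set_itvoc0; exact: measurable_fun_set0.
have v0 : 0 < vtx T k.
  case: k k0 IH kn => // k _ _ kn; have /andP[h _] := vtx_itv (ltnW (ltnW kn)).
  exact: le_lt_trans h (vtx_incr (ltnW kn)).
rewrite -(@setUitv1 _ _ (BRight 0) (vtx T k) true) ?bnd_simp//.
apply/measurable_funU => //; split; first exact: IH (ltnW kn).
exact: measurable_fun_set1.
Qed.

Lemma Rintegral_mesh T f : mu.-integrable I (EFin \o f) ->
  \int[mu]_(x in I) f x =
  \sum_(j < nelt T) \int[mu]_(x in `]vtx T j, vtx T j.+1[) f x.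
Proof.
move=> intf.
have sub k : (k <= nelt T)%N -> mu.-integrable `]0, vtx T k[ (EFin \o f).
  move=> kn; apply: integrableS intf => //; apply: subset_itvl.
  by rewrite bnd_simp; have /andP[] := vtx_itv kn.
suff H k : (k <= nelt T)%N -> \int[mu]_(x in `]0, vtx T k[) f x =
    \sum_(j < k) \int[mu]_(x in `]vtx T j, vtx T j.+1[) f x.
  by have := H _ (leqnn _); rewrite vtx_last.
elim: k => [_|k IH kn].
  by rewrite vtx_first set_itvoo0 Rintegral_set0 big_ord0.
rewrite big_ord_recr/= -IH ?(ltnW kn)// (Rintegral_itv_bndo_bndc (sub _ (ltnW kn))).
have intk := sub _ kn; have /andP[k0 _] := vtx_itv (ltnW kn).
by rewrite -(@Rintegral_itvB _ _ _ _ (vtx T k) intk) ?bnd_simp ?vtx_incr// subrKC.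
Qed.

Lemma elementwise_bounded T f :
  (forall j, (j < nelt T)%N ->
    exists M, forall x, vtx T j < x < vtx T j.+1 -> `|f x| <= M) ->
  exists M, forall x, 0 <= x <= 1 -> `|f x| <= M.
Proof.
move=> bf; rewrite -(vtx_last T).
suff H k : (k <= nelt T)%N -> exists M, forall x, 0 <= x <= vtx T k -> `|f x| <= M.
  exact: H.
elim: k => [_|k IH kn].
  by exists `|f 0| => x; rewrite vtx_first -eq_le => /eqP <-.
have [M fM] := IH (ltnW kn); have [N fN] := bf _ kn.
exists (Num.max M (Num.max N `|f (vtx T k.+1)|)) => x /andP[x0 xk].
rewrite !le_max; have [xk'|kx] := leP x (vtx T k); first by rewrite fM ?x0.
move: xk; rewrite le_eqVlt => /predU1P[->|xk]; first by rewrite lexx !orbT.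
by rewrite fN ?kx ?orbT.
Qed.

Lemma Uspace_L2 T u : Uspace T u -> L2 u.
Proof.
move=> Uu.
have [M uM] : exists M, forall x, 0 <= x <= 1 -> `|u x| <= M.
  apply: (@elementwise_bounded T) => j jn; have [c uc] := Uu j jn.
  by exists `|c| => x /uc ->.
apply: (@bounded_L2 _ _ M) => [|x /andP[x0 x1]]; last by rewrite uM ?ltW.
apply: (@elementwise_measurable T) => j jn; have [c uc] := Uu j jn.
apply: (@eq_measurable_fun _ _ _ _ _ (cst c)) => // x.
by rewrite inE/= in_itv/= => /uc ->.
Qed.

Definition slope p T j := (p (vtx T j.+1) - p (vtx T j)) / hstep T j.

Lemma hstep_gt0 T j : (j < nelt T)%N -> 0 < hstep T j.
Proof. by move=> jn; rewrite subr_gt0 vtx_incr. Qed.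

Lemma Pspace_L2 T p : Pspace T p -> L2 p.
Proof. by move=> [cp _]; exact: within_continuous_L2. Qed.

(** Affinity is only assumed on the open cells; continuity carries it to the
    endpoints and identifies the coefficients with the nodal values. *)
Lemma Pspace_affine T p j x : Pspace T p -> (j < nelt T)%N ->
  vtx T j <= x <= vtx T j.+1 -> p x = p (vtx T j) + slope p T j * (x - vtx T j).
Proof.
move=> [cp /(_ j) pj] jn xj; have [a [b pab]] := pj jn.
have jj := vtx_incr jn.
have cpj : {within `[vtx T j, vtx T j.+1], continuous p}.
  apply: continuous_subspaceW cp => y; rewrite /= !in_itv/= => /andP[jy yj].
  have /andP[j0 _] := vtx_itv (ltnW jn); have /andP[_ j1] := vtx_itv jn.
  by rewrite (le_trans j0 jy) (le_trans yj j1).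
have [_ pl pr] := iffLR (continuous_within_itvP p jj) cpj.
have caff y : (fun x => a * x + b) @ y --> a * y + b.
  by apply: cvgD; [apply: cvgM; [exact: cvg_cst|exact: cvg_id]|exact: cvg_cst].
have el : p (vtx T j) = a * vtx T j + b.
  apply: (cvg_unique _ pl) => //.
  apply: cvg_trans (cvg_at_right_filter (caff (vtx T j))).
  apply: near_eq_cvg; near=> y; rewrite -pab//.
  by apply/andP; split => //; near: y; exact: nbhs_right_lt.
have er : p (vtx T j.+1) = a * vtx T j.+1 + b.
  apply: (cvg_unique _ pr) => //.
  apply: cvg_trans (cvg_at_left_filter (caff (vtx T j.+1))).
  apply: near_eq_cvg; near=> y; rewrite -pab//.
  by apply/andP; split => //; near: y; exact: nbhs_left_gt.
have -> : p x = a * x + b.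
  move: xj; rewrite !le_eqVlt => /andP[/predU1P[<- _ //|jx] /predU1P[->//|xj]].
  by rewrite pab ?jx.
have := hstep_gt0 jn; rewrite /slope er el /hstep => h0; field.
by rewrite gt_eqF.
Unshelve. all: by end_near. Qed.

Lemma derive1_Pspace T p j x : Pspace T p -> (j < nelt T)%N ->
  vtx T j < x < vtx T j.+1 -> derive1 p x = slope p T j.
Proof.
move=> Pp jn xj; rewrite derive1E.
have d : is_derive x 1 (fun y : R => p (vtx T j) + slope p T j * (y - vtx T j)) (slope p T j).
  by apply: is_derive_eq; rewrite /GRing.scale/=; ring.
rewrite (@near_eq_derive _ _ _ _ (fun y : R => p (vtx T j) + slope p T j * (y - vtx T j))).
  by rewrite derive_val.
have xj' : x \in `]vtx T j, vtx T j.+1[ by rewrite in_itv.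
apply: filterS (near_in_itvoo xj') => y; rewrite in_itv/= => /andP[jy yj].
by rewrite (Pspace_affine Pp jn)// !ltW.
Qed.

Lemma derive1_Uspace T p : Pspace T p -> Uspace T (derive1 p).
Proof. by move=> Pp j jn; exists (slope p T j) => x; exact: derive1_Pspace. Qed.

Lemma Rintegral_oo_derive1 (F F' : R -> R) (a b : R) : a < b ->
  (forall x, is_derive x 1 F (F' x)) -> continuous F' ->
  \int[mu]_(x in `]a, b[) F' x = F b - F a.
Proof.
move=> ab dF cF'; have cF : continuous F.
  move=> x; apply: differentiable_continuous; apply/derivable1_diffP.
  by have [] := dF x.
have wF' : {within `[a, b], continuous F'} by exact: continuous_subspaceT.
have iF' : mu.-integrable `[a, b] (EFin \o F').
  by apply: continuous_compact_integrable => //; exact: segment_compact.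
rewrite Rintegral_itv_bndo_bndc; last first.
  by apply: integrableS iF' => // x /=; rewrite !in_itv/= => /andP[/ltW -> /ltW].
rewrite Rintegral_itv_obnd_cbnd; last first.
  by apply: integrableS iF' => // x /=; rewrite !in_itv/= => /andP[/ltW ->].
rewrite /Rintegral (continuous_FTC2 ab wF' (F := F))//.
- split.
  + by move=> x _; have [] := dF x.
  + exact/cvg_at_right_filter/cF.
  + exact/cvg_at_left_filter/cF.
- by move=> x _; rewrite derive1E; have dx := dF x; rewrite derive_val.
Qed.

(** Integrating the derivative of [p * phi] over each cell leaves boundary terms
    that telescope, since [p] is continuous, to the values of [p * phi] at 0 and
    1, where [phi] vanishes. *)
Lemma Pspace_is_H1_deriv T p : Pspace T p -> is_H1_deriv p (derive1 p).
Proof.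
move=> Pp; have Lp := Pspace_L2 Pp; have Ldp := Uspace_L2 (derive1_Uspace Pp).
split => // phi tphi; have Lphi := test_fun_L2 tphi.
have Ldphi := derive1_test_fun_L2 tphi; have [phi0 phi1] := test_fun_ends tphi.
have [dphi cdphi _ _] := tphi.
apply/eqP; rewrite -addr_eq0; apply/eqP.
have i1 := L2_mul_integrable Lp Ldphi; have i2 := L2_mul_integrable Ldp Lphi.
rewrite /dotL2 -RintegralD// (@Rintegral_mesh T); last exact: (integrableD _ i1 i2).
rewrite (eq_bigr (fun j : 'I_(nelt T) =>
  p (vtx T j.+1) * phi (vtx T j.+1) - p (vtx T j) * phi (vtx T j))); last first.
  move=> [j jn] _ /=; have jj := vtx_incr jn.
  (* [p] itself may fail to be differentiable at the vertices, so it is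
     replaced by its affine extension from the cell. *)
  pose aff (x : R) := p (vtx T j) + slope p T j * (x - vtx T j).
  have daff x : is_derive x 1 aff (slope p T j).
    by apply: is_derive_eq; rewrite /GRing.scale/=; ring.
  have dF x : is_derive x 1 (fun x => aff x * phi x)
      (aff x * derive1 phi x + slope p T j * phi x).
    have da := daff x; have dp := derivableP (dphi x).
    by apply: is_derive_eq; rewrite /GRing.scale/= derive1E; ring.
  have cF : continuous (fun x => aff x * derive1 phi x + slope p T j * phi x).
    have ca : continuous aff.
      move=> x; apply: differentiable_continuous; apply/derivable1_diffP.
      by have [] := daff x.
    have cphi : continuous phi.
      by move=> x; exact/differentiable_continuous/derivable1_diffP.
    move=> x; apply: cvgD; apply: cvgM; [exact: ca|exact: cdphi|exact: cvg_cst|exact: cphi].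
  rewrite (Pspace_affine (x := vtx T j.+1) Pp jn) ?lexx ?ltW// -/(aff _).
  rewrite (_ : p (vtx T j) = aff (vtx T j)); last by rewrite /aff subrr mulr0 addr0.
  rewrite -(Rintegral_oo_derive1 jj dF cF); apply: eq_Rintegral => x.
  rewrite inE/= in_itv/= => xj; rewrite (derive1_Pspace Pp jn)//.
  by rewrite (@Pspace_affine T p j x)//; case/andP: xj => /ltW -> /ltW ->.
rewrite -(big_mkord xpredT (fun j => p (vtx T j.+1) * phi (vtx T j.+1) -
  p (vtx T j) * phi (vtx T j))) telescope_sumr//.
by rewrite vtx_last vtx_first phi0 phi1 !mulr0 subrr.
Qed.

Lemma sum_hstep T : \sum_(j < nelt T) hstep T j = 1.
Proof.
rewrite -(big_mkord xpredT (hstep T)) telescope_sumr//.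
by rewrite vtx_last vtx_first subr0.
Qed.

Lemma sqr_norm0_derive1 T p : Pspace T p ->
  norm0 (derive1 p) ^+ 2 = \sum_(j < nelt T) slope p T j ^+ 2 * hstep T j.
Proof.
move=> Pp; have L := Uspace_L2 (derive1_Uspace Pp).
rewrite sqr_norm0 /dotL2 (@Rintegral_mesh T); last exact: L2_mul_integrable.
apply: eq_bigr => -[j jn] _ /=.
rewrite (@eq_Rintegral _ _ _ _ _ (cst (slope p T j ^+ 2))); last first.
  by move=> x; rewrite inE/= in_itv/= => xj; rewrite (derive1_Pspace Pp jn xj).
rewrite Rintegral_cst//= lebesgue_measure_itv/= lte_fin vtx_incr//.
Qed.

(** The oscillation is at most the total variation [\sum_j |slope_j| h_j], the L^1
    norm of [p']; it is at most the L^2 norm because the [h_j] sum to 1. *)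
Lemma Pspace_oscillation T p x : Pspace T p -> 0 <= x <= 1 ->
  `|p x - p 0| <= norm0 (derive1 p).
Proof.
move=> Pp x01.
pose S k := \sum_(j < k) `|slope p T j| * hstep T j.
have h_ge0 j : (j < nelt T)%N -> 0 <= hstep T j by move=> jn; rewrite ltW ?hstep_gt0.
have osc k : (k <= nelt T)%N -> forall y, 0 <= y <= vtx T k -> `|p y - p 0| <= S k.
  elim: k => [_ y|k IH kn y /andP[y0 yk]].
    by rewrite vtx_first -eq_le => /eqP <-; rewrite subrr normr0 /S big_ord0.
  rewrite /S big_ord_recr/= -/(S k).
  have [yk'|ky] := leP y (vtx T k).
    by rewrite (le_trans (IH (ltnW kn) y _)) ?y0// lerDl mulr_ge0 ?h_ge0.
  rewrite (@Pspace_affine T p k y)// ?(ltW ky)// addrAC (le_trans (ler_normD _ _))//.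
  apply: lerD; first by apply: IH; rewrite ?(ltnW kn)// lexx andbT; case/andP: (vtx_itv (ltnW kn)).
  rewrite normrM ler_wpM2l// ger0_norm ?subr_ge0 ?(ltW ky)//.
  by rewrite lerB.
have S_ge0 : 0 <= S (nelt T) by apply: sumr_ge0 => -[j jn] _; rewrite mulr_ge0 ?h_ge0.
apply: (@le_trans _ _ (S (nelt T))); first by apply: osc; rewrite ?vtx_last.
rewrite -ler_sqr ?nnegrE ?norm0_ge0// (sqr_norm0_derive1 Pp) -subr_ge0.
(* The defect in the inequality is the variance of [|slope_j|] for the
   weights [h_j]. *)
rewrite (_ : _ - _ = \sum_(j < nelt T) (`|slope p T j| - S (nelt T)) ^+ 2 * hstep T j).
  by apply: sumr_ge0 => -[j jn] _; rewrite mulr_ge0 ?sqr_ge0 ?h_ge0.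
set s := S (nelt T).
rewrite [RHS](eq_bigr (fun j : 'I_(nelt T) => slope p T j ^+ 2 * hstep T j -
  2 * s * (`|slope p T j| * hstep T j) + s ^+ 2 * hstep T j)); last first.
  by move=> j _; rewrite sqrrB real_normK ?num_real//; ring.
rewrite big_split/= sumrB -!mulr_sumr sum_hstep -/(S _) -/s; ring.
Qed.

(** With [m] the mean of [p], the expansion of [||p - p 0||^2 <= ||p'||^2] reads
    [||p||^2 <= ||p'||^2 + 2 (p 0) m - (p 0)^2], and the last two terms are at
    most [m^2]. *)
Lemma sqr_norm0_Pspace T p : Pspace T p ->
  norm0 p ^+ 2 <= dotL2 p (cst 1) ^+ 2 + norm0 (derive1 p) ^+ 2.
Proof.
move=> Pp; have Lp := Pspace_L2 Pp.
pose c := - p 0; have Lc := cst_L2 c; have L1 := @cst_L2 R 1.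
have Ld := L2D Lp Lc; set d := (fun x => _) in Ld.
have dle : dotL2 d d <= norm0 (derive1 p) ^+ 2.
  rewrite -[leRHS]mulr1 -(dotL2_cst _ 1) /dotL2.
  apply: le_Rintegral => //; first exact: L2_mul_integrable.
    exact: L2_mul_integrable (cst_L2 _) (cst_L2 _).
  move=> x; rewrite /= in_itv/= => /andP[x0 x1].
  rewrite mulr1 -expr2 -real_normK ?num_real// lerXn2r ?nnegrE ?norm0_ge0//.
  by apply: (Pspace_oscillation Pp); rewrite !ltW.
have e : dotL2 d d = norm0 p ^+ 2 + 2 * c * dotL2 p (cst 1) + c ^+ 2.
  rewrite sqr_norm0 dotL2Dl// ![dotL2 _ d]dotL2C !dotL2Dl// dotL2_cst.
  rewrite (dotL2C (cst c) p) (_ : dotL2 p (cst c) = c * dotL2 p (cst 1)); first by ring.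
  rewrite (dotL2C p (cst 1)) -dotL2Zl// dotL2C.
  by apply: eq_dotL2 => x _ /=; rewrite mulr1.
have := sqr_ge0 (dotL2 p (cst 1) + c); nra.
Qed.

(** * Constants are combinations of the shape functions *)

(** Only the basis functions of the two ends of a cell live on it.  At a shared
    vertex several branches of [psi_basis] compete; they agree because of the
    values of [psi] at 0 and 1. *)
Lemma psi_basis_cell psi T k j x : psi 0 = 0 -> psi 1 = 1 ->
  (k < nelt T)%N -> (j <= nelt T)%N -> vtx T k <= x <= vtx T k.+1 ->
  psi_basis psi T j x =
   (if j == k then psi ((vtx T k.+1 - x) / hstep T k) else 0) +
   (if j == k.+1 then psi ((x - vtx T k) / hstep T k) else 0).
Proof.
move=> psi0 psi1 kn jn /andP[kx xk]; rewrite /psi_basis.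
have [jk|kj|->] := ltngtP j k; last first.
- rewrite kn kx xk (ltn_eqF (ltnSn k)) addr0; case: ifP => // /and3P[k0 _ xk'].
  have k1n : (k.-1 < nelt T)%N by rewrite prednK// ltnW.
  have xE : x = vtx T k by apply/eqP; rewrite eq_le xk'.
  have h0 := hstep_gt0 k1n; have h1 := hstep_gt0 kn.
  rewrite xE /hstep prednK// !divff//.
    by rewrite gt_eqF// subr_gt0 vtx_incr.
  by have := vtx_incr k1n; rewrite prednK// => h; rewrite gt_eqF// subr_gt0.
- rewrite add0r; have [jE|jk1] := eqVneq j k.+1; first by rewrite jE /= kx xk.
  have {}kj : (k.+1 < j)%N by rewrite ltn_neqAle eq_sym jk1.
  have j0 : (0 < j)%N by apply: leq_ltn_trans kj.
  have j1n : (j.-1 < nelt T)%N by rewrite prednK.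
  have kj1 : vtx T k.+1 <= vtx T j.-1 by apply: vtx_le (ltnW j1n); rewrite -ltnS prednK.
  have jj : vtx T j.-1 < vtx T j by have := vtx_incr j1n; rewrite prednK.
  case: ifP => [/and3P[_ jx _]|_].
    have -> : x = vtx T j.-1 by apply/eqP; rewrite eq_le jx (le_trans xk kj1).
    by rewrite subrr mul0r.
  rewrite ifF//; apply/negP => /and3P[_ jx _].
  by have := lt_le_trans jj (le_trans jx (le_trans xk kj1)); rewrite ltxx.
- have jk1 : vtx T j.+1 <= vtx T k by apply: vtx_le; rewrite ?(ltnW kn).
  have jj : vtx T j < vtx T j.+1 by apply/vtx_incr/(ltn_trans jk).
  rewrite (ltn_eqF (ltn_trans jk (ltnSn k))) addr0 ifF; last first.
    apply/negP => /and3P[_ _ xj].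
    by have := le_lt_trans xj (lt_le_trans jj (le_trans jk1 kx)); rewrite ltxx.
  case: ifP => // /and3P[_ _ xj].
  have -> : x = vtx T j.+1 by apply/eqP; rewrite eq_le xj (le_trans jk1 kx).
  by rewrite subrr mul0r.
Qed.

Lemma cst_Qspace psi T (c : R) : psi 0 = 0 ->
  (forall theta : R, 0 <= theta <= 1 -> psi theta + psi (1 - theta) = 1) ->
  Qspace psi T (cst c).
Proof.
move=> psi0 psi_sym.
have psi1 : psi 1 = 1 by have := psi_sym 0; rewrite lexx ler01 psi0 subr0 add0r => ->.
exists (fun=> c) => x /mesh_cell-/(_ T) [k kn xk].
rewrite -mulr_sumr (eq_bigr (fun j : 'I_(nelt T).+1 =>
  (if j == k :> nat then psi ((vtx T k.+1 - x) / hstep T k) else 0) +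
  (if j == k.+1 :> nat then psi ((x - vtx T k) / hstep T k) else 0))); last first.
  by move=> [j jn] _ /=; apply: psi_basis_cell.
have k1 : (k < (nelt T).+1)%N by exact: ltnW.
have k2 : (k.+1 < (nelt T).+1)%N by [].
rewrite big_split/= -!big_mkcond/= (big_pred1 (Ordinal k1)); last by [].
rewrite (big_pred1 (Ordinal k2)); last by [].
have h0 := hstep_gt0 kn; move: xk => /andP[kx xk].
rewrite addrC (_ : (vtx T k.+1 - x) / _ = 1 - (x - vtx T k) / hstep T k).
  rewrite psi_sym ?mulr1//; apply/andP; split; first by rewrite divr_ge0 ?(ltW h0)// subr_ge0.
  by rewrite ler_pdivrMr// mul1r lerB.
by move: h0; rewrite /hstep => h0; field; rewrite gt_eqF.
Qed.

End Mesh.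

(** * The uniform inf-sup condition *)

Theorem proposition7 (R : realType) (psi : R -> R)
  (psi_cont : {within `[0, 1], continuous psi})
  (psi_H1 : H1 psi)
  (psi0 : psi 0 = 0)
  (psi_orth : \int[lebesgue_measure]_(x in `[0, 1]) ((1 - x) * psi x) = 0)
  (psi_sym : forall theta : R, 0 <= theta <= 1 ->
     psi theta + psi (1 - theta) = 1)
  (delta K : R)
  (delta_def : delta = \int[lebesgue_measure]_(theta in `[0, 1]) psi theta ^+ 2)
  (K_def : K = 4 / 3 * (1 + Num.sqrt (12 * delta)))
  (alpha beta : R) (alpha_gt0 : 0 < alpha) (alpha_lt1 : alpha < 1)
  (beta_gt1 : 1 < beta)
  (C : R) (C_gt0 : 0 < C)
  (C_stab : forall T : mesh R, uniformly_regular alpha beta T ->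
     forall u, Uspace T u ->
     exists q, [/\ Qspace psi T q,
       dotL2 u (div q) = norm0 u ^+ 2 & norm1 q <= C * norm0 u])
  (rho : R) (rho_gt0 : 0 < rho)
  (rho_le : rho + Num.sqrt (K * rho) <=
            1 / C * Num.sqrt (1 - rho ^+ 2 - K * rho)) :
  forall T : mesh R, uniformly_regular alpha beta T ->
  forall u p, Uspace T u -> Pspace T p -> normV (u, p) = 1 ->
  exists v q, [/\ Uspace T v, Qspace psi T q,
    normV (v, q) <= 1 & rho <= bilin_gamma (u, p) (v, q)].
Proof.
move=> T regT u p Uu Pp; rewrite /normV /bilin_gamma /= => upV.
have Lu := Uspace_L2 Uu; have Lp := Pspace_L2 Pp.
have dp := Pspace_is_H1_deriv Pp.
have Udp := derive1_Uspace Pp; have Ldp := Uspace_L2 Udp.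
rewrite (norm0_div dp) in upV.
set d := norm0 (derive1 p) in upV *.
(* A constant is piecewise affine, so its divergence comes from the general case. *)
have cst_deriv (c : R) : is_H1_deriv (cst c) (derive1 (cst c)).
  apply: (@Pspace_is_H1_deriv _ T); split; first exact: cst_continuous.
  by move=> j _; exists 0, c => x _; rewrite mul0r add0r.
have cst_deriv0 (c : R) : is_H1_deriv (cst c) (cst 0).
  have := cst_deriv c; rewrite (_ : derive1 (cst c) = cst 0)//.
  by apply/funext => x; rewrite derive1_cst.
have norm0_div_cst (c : R) : norm0 (div (cst c)) = 0.
  by rewrite (norm0_div (cst_deriv0 c)) norm0_cst normr0.
have dot_div_cst f (c : R) : L2 f -> dotL2 f (div (cst c)) = 0.
  by move=> Lf; rewrite (dotL2_div (cst_deriv0 c))// dotL20.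
have U0 : Uspace T (cst 0) by move=> j _; exists 0.
have [rho_d|d_rho] := leP rho d.
  have d0 : 0 < d by exact: lt_le_trans rho_d.
  exists (fun x => d^-1 * derive1 p x), (cst 0); split.
  - by move=> j jn; have [c pc] := Udp j jn; exists (d^-1 * c) => x /pc ->.
  - exact: cst_Qspace.
  - rewrite norm0Z// -/d norm0_cst norm0_div_cst normfV gtr0_norm// mulVf ?gt_eqF//.
    by rewrite normr0 expr1n expr0n/= !addr0 sqrtr1.
  - have Ldp' := L2Z d^-1 Ldp.
    rewrite dotL20 dot_div_cst// !add0r dotL2C (dotL2_div dp)// dotL2Zl//.
    by rewrite -sqr_norm0 -/d expr2 mulKf ?gt_eqF.
set m := dotL2 p (cst 1).
have dot_p_cst (c : R) : dotL2 p (cst c) = c * m.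
  rewrite /m (dotL2C p (cst 1)) -dotL2Zl//; last exact: cst_L2.
  by rewrite dotL2C; apply: eq_dotL2 => x _ /=; rewrite mulr1.
have [rho_m|m_rho] := leP rho `|m|.
  exists (cst 0), (cst (Num.sg m)); split => //.
  - exact: cst_Qspace.
  - have m0 : m != 0 by rewrite -normr_gt0 (lt_le_trans rho_gt0).
    by rewrite !norm0_cst norm0_div_cst normr0 normr_sg m0 expr0n/= add0r addr0 expr1n sqrtr1.
  - by rewrite dot_p_cst dot_div_cst// dotL20 !addr0 -normrEsg.
have Kge : 4 / 3 <= K.
  by rewrite K_def; have := sqrtr_ge0 (12 * delta); lra.
set r := 1 - rho ^+ 2 - K * rho in rho_le.
have Krho : 0 <= Num.sqrt (K * rho) by exact: sqrtr_ge0.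
have C1 : 0 < 1 / C by rewrite divr_gt0.
have r_gt0 : 0 < r.
  rewrite ltNge; apply/negP => r0; move: rho_le; rewrite (ler0_sqrtr r0) mulr0; lra.
(* If [K < 2 rho], then [rho^2 + K rho > 3/4 K^2 >= 4/3], which contradicts
   [r > 0]. *)
have rhoK : 2 * rho <= K by rewrite /r in r_gt0; nra.
have p_small : norm0 p ^+ 2 <= K * rho.
  have := sqr_norm0_Pspace Pp; rewrite -/m -/d.
  have : m ^+ 2 <= rho ^+ 2 by rewrite -real_normK ?num_real// lerXn2r ?nnegrE// ltW.
  have : d ^+ 2 <= rho ^+ 2 by rewrite lerXn2r ?nnegrE ?norm0_ge0// ltW.
  nra.
have upV2 : norm0 u ^+ 2 + norm0 p ^+ 2 + d ^+ 2 = 1.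
  by rewrite -[LHS]sqr_sqrtr ?upV ?expr1n// !addr_ge0 ?sqr_ge0.
have u_large : Num.sqrt r <= norm0 u.
  rewrite -ler_sqr ?nnegrE ?norm0_ge0 ?sqrtr_ge0// sqr_sqrtr ?(ltW r_gt0)//.
  have : d ^+ 2 <= rho ^+ 2 by rewrite lerXn2r ?nnegrE ?norm0_ge0// ltW.
  rewrite /r; lra.
have u_gt0 : 0 < norm0 u by apply: lt_le_trans u_large; rewrite sqrtr_gt0.
(* The hypothesis is used for a multiple of [u] and its [q] is left unscaled:
   this factor turns the bound on [norm1 q] into 1. *)
pose l := (C * norm0 u)^-1; have l_gt0 : 0 < l by rewrite invr_gt0 mulr_gt0.
have Ulu : Uspace T (fun x => l * u x).
  by move=> j jn; have [c uc] := Uu j jn; exists (l * c) => x /uc ->.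
have [q [Qq luq q1]] := C_stab T regT _ Ulu.
(* Outside H^1 the divergence is the dummy 0, which is not compatible with
   [(l u, div q) = ||l u||^2 > 0]. *)
have [[g qg]|nq] := pselect (H1 q); last first.
  have : div q = cst 0 by rewrite /div; case: xgetP => // g _ qg; case: nq; exists g.
  move=> dq0; move: luq; rewrite dq0 dotL20 norm0Z// => /esym/eqP.
  by rewrite expf_eq0/= mulf_eq0 normr_eq0 !gt_eqF.
have qd := is_H1_deriv_div qg; have [Lq Ldq _] := qd.
have dot_u : dotL2 u (div q) = norm0 u / C.
  move: luq; rewrite norm0Z// dotL2Zl// gtr0_norm// => e.
  apply: (mulfI (lt0r_neq0 l_gt0)); rewrite e /l; field.
  by rewrite !gt_eqF.
have q1' : norm1 q <= 1.
  by rewrite (le_trans q1)// norm0Z// gtr0_norm// mulrCA /l mulVf ?gt_eqF ?mulr_gt0.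
exists (cst 0), q; split => //.
  by rewrite norm0_cst normr0 expr0n/= add0r.
rewrite dotL20 addr0 dot_u.
have q0 : norm0 q <= 1.
  apply: le_trans q1'; rewrite -[leLHS](ger0_norm (norm0_ge0 q)) -sqrtr_sqr.
  by rewrite ler_wsqrtr// lerDl sqr_ge0.
have pK : norm0 p <= Num.sqrt (K * rho).
  by rewrite -[leLHS](ger0_norm (norm0_ge0 p)) -sqrtr_sqr ler_wsqrtr.
have pq : - Num.sqrt (K * rho) <= dotL2 p q.
  rewrite lerNl (le_trans _ pK)// (le_trans (ler_norm _))// normrN.
  by rewrite (le_trans (ler_dotL2 Lp Lq))// ler_piMr ?norm0_ge0.
have : 1 / C * Num.sqrt r <= norm0 u / C by rewrite mul1r mulrC ler_wpM2r// invr_ge0 ltW.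
lra.
Qed.
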